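(* Let $(X,d,A)$ be a metric pair with $A$ not isolated, let $Y$ be a topological space that contains a nontrivial path, and let $p\in[1,\infty]$. Then the function spaces $C((D(X,A),W_p),Y)$ and $C((\overline{D}_p(X,A),W_p),Y)$, equipped with the compact-open topology, are not metrizable.
   Context: A metric on $X$ is a map $d:X\times X\to[0,\infty]$ with $d(x,x)=0$, symmetry and the triangle inequality (infinite distances allowed, $d(x,y)=0$ need not imply $x=y$); a metric pair $(X,d,A)$ is such a space with a closed subset $A$. Write $d(x,A)=\inf_{a\in A}d(x,a)$, $A^\delta=\{x:d(x,A)<\delta\}$ for $\delta\in(0,\infty]$; $A$ is isolated if $A^\delta=A$ for some $\delta>0$. $\overline{D}(X,A)$ is the set of countable formal sums $\hat\alpha=\sum_{i\in I}x_i$ of points of $X\setminus A$ (repetitions allowed); $D(X,A)$ the finite ones; $0$ the empty sum. A matching of $\hat\alpha=\sum_{i\in I}x_i$, $\hat\beta=\sum_{j\in J}y_j$ is a formal sum $\sum_{k\in K}(x_k,y_{\varphi(k)})+\sum_{i\in I\setminus K}(x_i,z_i)+\sum_{j\in J\setminus\varphi(K)}(w_j,y_j)$ with $K\subset I$, $\varphi$ injective, $z_i,w_j\in A$; its $p$-cost is the $\ell^p$ norm (sup norm if $p=\infty$) of the distances of paired points; $W_p$ is the infimum of $p$-costs. $u_\delta(\alpha)$, $\ell_\delta(\alpha)$ are the restrictions of $\hat\alpha$ to $X\setminus A^\delta$ and to $A^\delta\setminus A$. For $p<\infty$, $\overline{D}_p(X,A)=\{\alpha: |u_\infty(\alpha)|<\infty,\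 W_p(\ell_\infty(\alpha),0)<\infty\}$; $\overline{D}_\infty(X,A)=\{\alpha:|u_\delta(\alpha)|<\infty\ \forall\delta>0\}$. $C(Z,Y)$ denotes the space of continuous maps $Z\to Y$; a nontrivial path is a non-constant continuous map $[0,1]\to Y$. *)

(* Defs.v *)
From HB Require Import structures.
From mathcomp Require Import all_boot all_order all_algebra.
From mathcomp Require Import all_classical all_reals all_analysis.

Set Implicit Arguments.
Unset Strict Implicit.
Unset Printing Implicit Defensive.
Import Order.TTheory GRing.Theory Num.Theory.
Import numFieldTopology.Exports numFieldNormedType.Exports.

Local Open Scope classical_set_scope.
Local Open Scope ring_scope.

(* d(x,x)=0, symmetry, triangle inequality; d(x,y)=0 need not imply x=y *)
Definition is_ext_metric (R : realType) (X : Type) (d : X -> X -> \bar R) :=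
  [/\ (forall x y, (0 <= d x y)%E), (forall x, d x x = 0%E),
      (forall x y, d x y = d y x) &
      (forall x y z, (d x z <= d x y + d y z)%E)].

Definition dist_to (R : realType) (X : Type) (d : X -> X -> \bar R) (A : set X)
  (x : X) : \bar R := ereal_inf [set d x a | a in A].

Definition dclosed (R : realType) (X : Type) (d : X -> X -> \bar R) (A : set X) :=
  forall x, dist_to d A x = 0%E -> A x.

Definition thicken (R : realType) (X : Type) (d : X -> X -> \bar R) (A : set X)
  (delta : \bar R) : set X := [set x | (dist_to d A x < delta)%E].

Definition isolated_pair (R : realType) (X : Type) (d : X -> X -> \bar R) (A : set X) :=
  exists delta : \bar R, (0 < delta)%E /\ thicken d A delta = A.

(* A countable formal sum of points of X \ A (up to reordering) is encoded by
   its multiplicity function: [Some n] = multiplicity n, [None] = countably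
   infinite multiplicity. *)
Definition is_dgm (X : Type) (A : set X) (m : X -> option nat) :=
  (forall x, A x -> m x = Some 0%N) /\ countable [set x | m x <> Some 0%N].

Definition Dgm (X : Type) (A : set X) := {m : X -> option nat | is_dgm A m}.

Definition total_finite (X : Type) (m : X -> option nat) :=
  finite_set [set x | m x <> Some 0%N] /\ (forall x, m x <> None).

Definition hascard (S : set nat) (o : option nat) :=
  match o with Some n => is_true (S #= `I_n)%card | None => infinite_set S end.

(* (I, x) is an enumeration  sum_{i in I} x_i  of the formal sum [m] *)
Definition represents (X : Type) (m : X -> option nat) (I : set nat)
  (x : nat -> X) := forall y, hascard [set i | I i /\ x i = y] (m y).

Definition matching_costs (R : realType) (X : Type) (d : X -> X -> \bar R)
  (A : set X) (p : \bar R) (m1 m2 : X -> option nat) : set (\bar R) :=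
  [set c | exists (I J K : set nat) (x y z w : nat -> X) (phi : nat -> nat),
    [/\ represents m1 I x, represents m2 J y,
      [/\ K `<=` I,
        (forall k1 k2, K k1 -> K k2 -> phi k1 = phi k2 -> k1 = k2) &
        phi @` K `<=` J],
      [/\ (forall i, (I `\` K) i -> A (z i)) &
        (forall j, (J `\` phi @` K) j -> A (w j))] &
      c = match p with
          | r%:E =>
            poweR ((\esum_(k in K) poweR (d (x k) (y (phi k))) r)
                 + (\esum_(i in I `\` K) poweR (d (x i) (z i)) r)
                 + (\esum_(j in J `\` phi @` K) poweR (d (w j) (y j)) r))%E
                  r^-1
          | _ => ereal_sup ([set 0%E]
                   `|` [set d (x k) (y (phi k)) | k in K]
                   `|` [set d (x i) (z i) | i in I `\` K]
                   `|` [set d (w j) (y j) | j in J `\` phi @` K])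
          end]].

Definition Wp (R : realType) (X : Type) (d : X -> X -> \bar R) (A : set X)
  (p : \bar R) (m1 m2 : X -> option nat) : \bar R :=
  ereal_inf (matching_costs d A p m1 m2).

Definition zero_dgm (X : Type) : X -> option nat := fun _ => Some 0%N.

Definition restr (X : Type) (S : set X) (m : X -> option nat) : X -> option nat :=
  fun x => if `[< S x >] then m x else Some 0%N.

Definition u_part (R : realType) (X : Type) (d : X -> X -> \bar R) (A : set X)
  (delta : \bar R) (m : X -> option nat) :=
  restr (~` thicken d A delta) m.
Definition l_part (R : realType) (X : Type) (d : X -> X -> \bar R) (A : set X)
  (delta : \bar R) (m : X -> option nat) :=
  restr (thicken d A delta `\` A) m.

Definition dtop (T : Type) (R : realType) (dist : T -> T -> \bar R) : Type := T.

Definition dist_open (T : Type) (R : realType) (dist : T -> T -> \bar R)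
  : set (set T) :=
  [set U | forall a, U a ->
     exists2 e : R, 0 < e & [set b | (dist a b < e%:E)%E] `<=` U].

Section dtop_instance.
Context (T : Type) (R : realType) (dist : T -> T -> \bar R).

HB.instance Definition _ := gen_eqMixin (dtop dist).
HB.instance Definition _ := gen_choiceMixin (dtop dist).

Let opT : dist_open dist setT.
Proof. by move=> a _; exists 1. Qed.

Let opI : setI_closed (dist_open dist).
Proof.
move=> U V oU oV a [Ua Va].
have [e1 e1p sU] := oU a Ua; have [e2 e2p sV] := oV a Va.
exists (Order.min e1 e2); first by rewrite lt_min e1p e2p.
move=> b /= h; split.
- by apply: sU; apply: (lt_le_trans h); rewrite lee_fin ge_min lexx.
- by apply: sV; apply: (lt_le_trans h); rewrite lee_fin ge_min lexx orbT.
Qed.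

Let opU (I : Type) (f : I -> set T) : (forall i, dist_open dist (f i)) ->
  dist_open dist (\bigcup_i f i).
Proof.
move=> hf a [i _ fia]; have [e ep s] := hf i a fia.
by exists e => // b /s fib; exists i.
Qed.

HB.instance Definition _ :=
  isOpenTopological.Build (dtop dist) opT opI opU.

End dtop_instance.

Definition DgmW (R : realType) (X : Type) (d : X -> X -> \bar R) (A : set X)
  (p : \bar R) : topologicalType :=
  dtop (fun a b : Dgm A => Wp d A p (sval a) (sval b)).

Definition Dfin (R : realType) (X : Type) (d : X -> X -> \bar R) (A : set X)
  (p : \bar R) : set (DgmW d A p) :=
  [set a | total_finite (sval (a : Dgm A))].

Definition Dbar (R : realType) (X : Type) (d : X -> X -> \bar R) (A : set X)
  (p : \bar R) : set (DgmW d A p) :=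
  match p with
  | +oo%E => [set a | forall delta : \bar R, (0 < delta)%E ->
                total_finite (u_part d A delta (sval (a : Dgm A)))]
  | _ => [set a | total_finite (u_part d A +oo%E (sval (a : Dgm A))) /\
            (Wp d A p (l_part d A +oo%E (sval (a : Dgm A))) (@zero_dgm X)
               < +oo)%E]
  end.

Arguments Dfin {R X} d A p _.
Arguments Dbar {R X} d A p _.

Definition Cco (U V : topologicalType) : Type := continuousType U V.
HB.instance Definition _ (U V : topologicalType) := Choice.on (Cco U V).
HB.instance Definition _ (U V : topologicalType) :=
  Topological.copy (Cco U V)
    (initial_topology (fun f : Cco U V => (f : {compact-open, U -> V}))).

Definition metrizable (R : realType) (T : topologicalType) :=
  exists m : T -> T -> R,
    [/\ (forall x y, 0 <= m x y), (forall x y, m x y = 0 <-> x = y),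
        (forall x y, m x y = m y x),
        (forall x y z, m x z <= m x y + m y z) &
        (forall U : set T, open U <->
           forall x, U x -> exists2 e : R, 0 < e & [set y | m x y < e] `<=` U)].

Definition has_nontrivial_path (R : realType) (Y : topologicalType) :=
  exists gamma : R -> Y,
    {within [set t : R | 0 <= t <= 1], continuous gamma} /\
    exists s t : R, [/\ 0 <= s <= 1, 0 <= t <= 1 & gamma s <> gamma t].

(* Main.v *)
(* For a diagram m let N_n(m) be the l^p norm of the distances to A of the points
   of m after the best removal of n points. Each N_n is 1-Lipschitz for W_p (by
   Minkowski's inequality), N_n decreases with n, and N_n -> 0 on finite diagrams
   and on \overline{D}_p. By Dini's argument N_n is eventually uniformly small on
   a compact set K of diagrams, whereas for x close to A and M large the diagram
   M x is close to 0 and N_n(M x) stays bounded below. So every compact K can be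
   separated by a continuous real function from a point arbitrarily close to 0.
   Composing with a path of Y, no countable family of compact-open
   neighbourhoods is a base at a constant map. *)
Require Import Defs.
From HB Require Import structures.
From mathcomp Require Import all_boot all_order all_algebra.
From mathcomp Require Import all_classical all_reals all_analysis.
From mathcomp Require Import ring lra.
Import Order.TTheory GRing.Theory Num.Theory.
Import numFieldTopology.Exports numFieldNormedType.Exports.
Local Open Scope classical_set_scope.
Local Open Scope ring_scope.

Set Implicit Arguments.
Unset Strict Implicit.
Unset Printing Implicit Defensive.

(** * Compact-open topology *)

Section FunctionSpace.
Context {R : realType} {Z Y : topologicalType}.

Definition mkCco (f : Z -> Y) (cf : continuous f) : Cco Z Y := mkcts cf.

Definition constC (y : Y) : Cco Z Y := mkCco (fun x => @cst_continuous Z Y y x).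

(** Finitely many subbasic neighbourhoods of a constant map contain a single one: take the union of
    the compact sets and the intersection of the open ones. *)
Lemma constC_nbhs (y : Y) (W : set (Cco Z Y)) : open W -> W (constC y) ->
  exists (K : set Z) (V : set Y), [/\ compact K, open V, V y &
    forall g : Cco Z Y, (forall z, K z -> V ((g : Z -> Y) z)) -> W g].
Proof.
move=> [W' oW' <-] /= W'y.
pose F : set_system {compact-open, Z -> Y} := filter_from
  [set KV : set Z * set Y | [/\ compact KV.1, open KV.2 & KV.2 y]]
  (fun KV => [set g | g @` KV.1 `<=` KV.2]).
have FF : Filter F.
  apply: filter_from_filter.
    by exists (set0, setT); split => //=; [exact: compact0 | exact: openT].
  move=> [K1 V1] [K2 V2] [/= cK1 oV1 V1y] [/= cK2 oV2 V2y].
  exists (K1 `|` K2, V1 `&` V2).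
    by split => //=; [exact: compactU | exact: openI].
  move=> g /= gV; split=> _ [z Kz <-].
    by have [] : (V1 `&` V2) (g z) by apply: gV; exists z => //; left.
  by have [] : (V1 `&` V2) (g z) by apply: gV; exists z => //; right.
have : F --> (cst y : {compact-open, Z -> Y}).
  apply/compact_open_cvgP => K V cK oV KV.
  (* For empty [K] the value [y] need not lie in [V], so the trivial pair is used instead. *)
  have [->|/set0P[z Kz]] := eqVneq K set0.
    exists (set0, setT); first by split => //=; [exact: compact0 | exact: openT].
    by move=> g _ _ [? []].
  exists (K, V) => //=; split => //=.
  by apply: KV; exists z.
move=> /(_ W'); case.
  by apply: open_nbhs_nbhs; split.
move=> [K V] [/= cK oV Vy] KVW; exists K, V; split => // g gV.
by apply: KVW => /= _ [z Kz <-]; exact: gV.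
Qed.

Lemma Cco_subbasic_open (K : set Z) (V : set Y) : compact K -> open V ->
  open [set g : Cco Z Y | forall z, K z -> V ((g : Z -> Y) z)].
Proof.
move=> cK oV; exists [set g | g @` K `<=` V]; first exact: compact_open_open.
apply/seteqP; split=> g /= gV; first by move=> z Kz; apply: gV; exists z.
by move=> _ [z Kz <-]; exact: gV.
Qed.

End FunctionSpace.

(** A neighbourhood of the limit handles a whole tail; the finitely many earlier terms are added one
    at a time, by induction on [N]. *)
Lemma cvg_seq_compact {Z : topologicalType} (u : nat -> Z) (z : Z) :
  u @ \oo --> z -> compact (z |` range u).
Proof.
move=> uz; apply/compact_near_coveringP => J F P FF Pnear.
have [[U1 F1] /= [U1z FF1] UF1] := Pnear z (or_introl erefl).
have [N _ NU] := uz _ U1z.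
have FN : F (\bigcap_(n in `I_N) [set i | P i (u n)]).
  elim: N {NU} => [|N IHN]; first by apply: filterS FF1 => i _ n; rewrite /= ltn0.
  have [[U2 F2] /= [U2z FF2] UF2] :=
    Pnear (u N) (or_intror (ex_intro2 _ _ N I erefl)).
  apply: filterS (filterI IHN FF2) => i [iN F2i] n /=.
  rewrite ltnS leq_eqVlt => /predU1P[->|]; last exact: iN.
  by apply: (UF2 (u N, i)); split => //=; exact: nbhs_singleton.
apply: filterS (filterI FN FF1) => i [iN F1i] x [->|[n _ <-]].
  by apply: (UF1 (z, i)); split => //=; exact: nbhs_singleton.
have [nN|nN] := ltnP n N; first exact: iN.
by apply: (UF1 (u n, i)); split => //=; exact: NU.
Qed.

(** Extending the path by constants to the whole line allows composition with any continuous real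
    function. *)
Lemma has_nontrivial_path_line {R : realType} {Y : topologicalType} :
  has_nontrivial_path R Y -> exists h : R -> Y,
    [/\ continuous h, h 0 <> h 1,
        (forall u, u <= 0 -> h u = h 0) & (forall u, 1 <= u -> h u = h 1)].
Proof.
move=> [gamma [cgamma [s [t [s01 t01 gst]]]]].
(* Clamping to [[0, 1]], then the affine map sending 0 to [s] and 1 to [t], which may come in either
   order. *)
pose c (u : R) : R := s + (t - s) * Num.max 0 (Num.min 1 u).
have c0 u : u <= 0 -> c u = s.
  by move=> u0; rewrite /c max_l ?mulr0 ?addr0// ge_min u0 orbT.
have c1 u : 1 <= u -> c u = t.
  move=> u1; rewrite /c min_l// max_r// mulr1.
  by rewrite addrC subrK.
have c01 u : 0 <= c u <= 1.
  have [/c0 ->//|u0] := leP u 0; have [/c1 ->//|u1] := leP 1 u.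
  rewrite /c (min_r (ltW u1)) (max_r (ltW u0)).
  case/andP: s01 => s0 s1; case/andP: t01 => t0 t1.
  have -> : s + (t - s) * u = s * (1 - u) + t * u by ring.
  apply/andP; split; first by rewrite addr_ge0// mulr_ge0// ?subr_ge0 ltW.
  rewrite -[leRHS](subrK u) lerD//.
    by rewrite ler_piMl// subr_ge0 ltW.
  by rewrite ler_piMl// ltW.
have cl : continuous (cst 0 \max (cst 1 \min id) : R -> R^o).
  move=> u; apply: continuous_max; first exact: cst_continuous.
  by apply: continuous_min; [exact: cst_continuous | exact: cvg_id].
have cc : continuous c.
  move=> u; apply: cvgD; first exact: cvg_cst.
  apply: cvgM; first exact: cvg_cst.
  exact: cl.
exists (gamma \o c); split => //=.
- move=> u V gV.
  have cV : within [set t : R | 0 <= t <= 1] (nbhs (c u)) (gamma @^-1` V).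
    have := cgamma (c u) V gV.
    by rewrite /nbhs /= -nbhs_subspace_in; last exact: (c01 u).
  have {}cV := cc u _ cV.
  apply: (@filterS _ (nbhs u) _ (fun v => 0 <= c v <= 1 -> V (gamma (c v)))) cV.
  by move=> v /= cvV; exact: (cvV (c01 v)).
- by rewrite c0// c1.
- by move=> u u0; rewrite !c0.
- by move=> u u0; rewrite !c1.
Qed.

(* Given a countable base at a constant map, pick a basic set [K_n, V_n] inside
   the n-th ball and a function separating K_n from some point z_n close to z;
   the set formed by z and the z_n is compact, yet the separating functions
   do not converge uniformly on it. *)
Lemma Cco_not_metrizable {R : realType} {Z Y : topologicalType} (z : Z)
    (B : nat -> set Z) :
  has_nontrivial_path R Y ->
  (forall u : nat -> Z, (forall n, B n (u n)) -> u @ \oo --> z) ->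
  (forall (K : set Z) n, compact K -> exists (x : Z) (f : Z -> R),
     [/\ B n x, continuous f, (forall y, K y -> f y <= 0) & f x = 1]) ->
  ~ metrizable R (Cco Z Y).
Proof.
move=> /has_nontrivial_path_line[h [ch h01 h0 h1]] Bz sep.
move=> [m [m_ge0 m_eq0 mC m_tri m_open]].
pose c0 : Cco Z Y := constC (h 0).
pose ball e := [set g : Cco Z Y | m c0 g < e].
have ball_open e : open (ball e).
  apply/m_open => g /= ge; exists (e - m c0 g); first by rewrite subr_gt0.
  move=> k /=; rewrite ltrBrDl; apply: le_lt_trans; exact: m_tri.
have ballc0 e : 0 < e -> ball e c0.
  by move=> e0; rewrite /ball /= (m_eq0 c0 c0).2.
(* The metric separates the constant maps at [h 0] and [h 1]: a basic neighbourhood of the first,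
   inside a ball missing the second, has an open part missing [h 1]. *)
have [V oV [V0 V1]] : exists2 V : set Y, open V & V (h 0) /\ ~ V (h 1).
  have e0 : 0 < m c0 (constC (h 1)).
    rewrite lt_def m_ge0 andbT; apply/eqP => /m_eq0.
    move=> /(congr1 (fun g : Cco Z Y => (g : Z -> Y) z)).
    exact: h01.
  have [K [V [cK oV V0 KV]]] := constC_nbhs (ball_open _) (ballc0 _ e0).
  exists V => //; split => // V1.
  have := KV (constC (h 1)) (fun _ _ => V1).
  by rewrite /ball /= ltxx.
have step n : exists x : Z, exists2 g : Cco Z Y, B n x &
    ball n.+1%:R^-1 g /\ (g : Z -> Y) x = h 1.
  have /(ballc0) b0 : 0 < n.+1%:R^-1 :> R by rewrite invr_gt0.
  have [K [V' [cK oV' V'0 KV']]] := constC_nbhs (ball_open _) b0.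
  have [x [f [Bx cf f0 f1]]] := sep K n cK.
  (* As [h] is constant on the negative half-line, [h \o f] equals [h 0] on [K] and so lies in the
     ball, although its value at [x] is [h 1]. *)
  have chf : continuous (h \o f).
    by move=> y; apply: continuous_comp; [exact: cf | exact: ch].
  exists x, (mkCco chf) => //; split; last exact: (congr1 h f1).
  by apply: KV' => y Ky; rewrite [X in V' X](h0 (f y) (f0 y Ky)).
have [u {}step] := choice step.
have uz : u @ \oo --> z by apply: Bz => n; have [] := step n.
(* The maps sending [z] and all [u n] into [V] form an open set around [c0], hence contain a ball;
   for large [n] the [n]-th map lies in that ball but takes the value [h 1] at [u n]. *)
have oS := Cco_subbasic_open (cvg_seq_compact uz) oV.
have [e e0 eS] := (m_open _).1 oS c0 (fun _ _ => V0).
have [n ne] : exists n : nat, n.+1%:R^-1 < e.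
  exists (Num.truncn e^-1); rewrite invf_plt ?posrE//.
  exact: truncnS_gt.
have [g Bu [gn gu]] := step n.
apply: V1; rewrite -gu; apply: (eS g); first exact: (lt_trans gn).
by right; exists n.
Qed.

(** * Discrete l^p norms *)

Section LNorm.
Context {R : realType}.
Local Open Scope ereal_scope.
Implicit Types (S T : set nat) (f g : nat -> \bar R) (p : \bar R).

Lemma le_poweR (r : R) (x y : \bar R) : (0 < r)%R -> 0 <= x -> x <= y ->
  poweR x r <= poweR y r.
Proof.
move=> r0 x0 xy; apply: gt0_ler_poweR => //; first exact: ltW.
  by rewrite in_itv/= x0 leey.
by rewrite in_itv/= (le_trans x0 xy) leey.
Qed.

(** The estimates below assume [1 <= p], so there the second branch is the sup norm for [+oo]; the
    added 0 gives an empty index set norm 0 instead of [-oo]. *)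
Definition lnorm p S f : \bar R :=
  match p with
  | r%:E => poweR (\esum_(i in S) poweR (f i) r) r^-1
  | _ => ereal_sup ([set 0] `|` [set f i | i in S])
  end.

Lemma le_lnorm p S T f g : 1 <= p -> S `<=` T ->
  (forall i, S i -> 0 <= f i <= g i) -> (forall i, T i -> 0 <= g i) ->
  lnorm p S f <= lnorm p T g.
Proof.
case: p => [r||]// p1 ST fg g0 /=.
  have r0 : (0 < r)%R by rewrite -lte_fin (lt_le_trans lte01).
  have e0 S' h : 0 <= \esum_(i in S') poweR (h i) r.
    by apply: esum_ge0 => *; exact: poweR_ge0.
  apply: le_poweR; [by rewrite invr_gt0 | exact: e0 |].
  apply: (@le_trans _ _ (\esum_(i in S) poweR (g i) r)).
    apply: le_esum => i Si; have /andP[fi0 fgi] := fg i Si.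
    exact: le_poweR.
  apply: ereal_sup_le => _ [F [finF FS] <-]; exists F => //; split => //.
  exact: subset_trans ST.
apply: ge_ereal_sup => _ [->|[i Si <-]].
  by apply: ereal_sup_ubound; left.
have /andP[_ fgi] := fg i Si; apply: (le_trans fgi).
by apply: ereal_sup_ubound; right; exists i => //; exact: ST.
Qed.

Lemma lnorm_ge p S f i : 1 <= p -> (forall j, S j -> 0 <= f j) -> S i ->
  f i <= lnorm p S f.
Proof.
case: p => [r||]// p1 f0 Si /=; last first.
  by apply: ereal_sup_ubound; right; exists i.
have r0 : (0 < r)%R by rewrite -lte_fin (lt_le_trans lte01).
rewrite -[leLHS](poweRe1 (f0 i Si)) -(@mulfV _ r) ?gt_eqF// poweRrM.
apply: le_poweR; [by rewrite invr_gt0 | exact: poweR_ge0 |].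
apply: esum_ge; exists [set i].
  by split; [exact: finite_set1 | move=> _ ->].
by rewrite fsbig_set1.
Qed.

Lemma lnorm_ge0 p S f : 1 <= p -> 0 <= lnorm p S f.
Proof.
case: p => [r||]// _ /=; first exact: poweR_ge0.
by apply: ereal_sup_ubound; left.
Qed.

Lemma eq_lnorm p S f g : (forall i, S i -> f i = g i) ->
  lnorm p S f = lnorm p S g.
Proof.
move=> fg; case: p => [r||] /=; last 2 first.
- by rewrite (eq_imagel fg).
- by rewrite (eq_imagel fg).
by congr poweR; apply: eq_esum => i Si; rewrite fg.
Qed.

Lemma lnorm_image p S (e : nat -> nat) f : set_inj S e ->
  lnorm p (e @` S) f = lnorm p S (f \o e).
Proof.
by move=> eI; case: p => [r||] /=; rewrite ?esum_image// image_comp.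
Qed.

Lemma lnorm_supp p S T f : 1 <= p -> (forall i, S i -> ~ T i -> f i = 0) ->
  lnorm p S f <= lnorm p (S `&` T) f.
Proof.
case: p => [r||]// p1 f0 /=.
  have r0 : r != 0%R.
    by rewrite gt_eqF// -lte_fin (lt_le_trans lte01).
  rewrite esum_mkcondr le_eqVlt; apply/orP; left; apply/eqP; congr poweR.
  apply: eq_esum => i Si; case: ifPn => // /negP; rewrite inE => /(f0 i Si) ->.
  exact: poweR0r.
apply: ge_ereal_sup => _ [->|[i Si <-]]; apply: ereal_sup_ubound; first by left.
have [Ti|/(f0 i Si) ->] := pselect (T i); last by left.
by right; exists i.
Qed.

(** Passing to the counting measure, with [f] extended by 0 outside [S], gives access to Minkowski's
    inequality. *)
Lemma lnormE_Lnorm r S (f : nat -> R) : (1 <= r)%R ->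
  (forall i, 0 <= f i)%R ->
  lnorm r%:E S (EFin \o f) =
  Lnorm counting r%:E (EFin \o (fun i => if i \in S then f i else 0))%R.
Proof.
move=> r1 f0; have r0 : (0 < r)%R by exact: lt_le_trans r1.
rewrite Lnorm_counting// nneseries_esumT; last by move=> *; exact: poweR_ge0.
congr poweR; rewrite esum_mkcond; apply: eq_esum => i _ /=.
case: ifPn => _; last by rewrite normr0 powR0// gt_eqF.
by rewrite ger0_norm.
Qed.

Lemma lnormD p S f g : 1 <= p -> (forall i, S i -> 0 <= f i) ->
  (forall i, S i -> 0 <= g i) ->
  lnorm p S (fun i => f i + g i) <= lnorm p S f + lnorm p S g.
Proof.
move=> p1 f0 g0.
(* An infinite term on the left makes the right-hand side infinite; otherwise all terms on [S] are
   finite, as Minkowski's inequality for real functions requires. *)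
have [[i Si /negP fgi]|/forall2NP fgfin] :=
    pselect (exists2 i, S i & ~~ (f i + g i < +oo)).
  suff -> : lnorm p S f + lnorm p S g = +oo by rewrite leey.
  apply/eqP; rewrite -leye_eq; move/negP: fgi; rewrite -leNgt => fgi.
  by apply: (le_trans fgi); apply: leeD; exact: lnorm_ge.
have {}fgfin i : S i -> f i + g i < +oo.
  by move=> Si; have [//|/negP/negPn] := fgfin i.
have ffin i : S i -> f i \is a fin_num.
  move=> Si; rewrite ge0_fin_numE ?f0//; apply: le_lt_trans (fgfin i Si).
  by rewrite leeDl// g0.
have gfin i : S i -> g i \is a fin_num.
  move=> Si; rewrite ge0_fin_numE ?g0//; apply: le_lt_trans (fgfin i Si).
  by rewrite leeDr// f0.
case: p p1 => [r||]// p1; last first.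
  apply: ge_ereal_sup => _ [->|[i Si <-]].
    by apply: adde_ge0; exact: (@lnorm_ge0 +oo).
  by apply: leeD; apply: (@lnorm_ge +oo).
pose f' i := if i \in S then fine (f i) else 0%R.
pose g' i := if i \in S then fine (g i) else 0%R.
have f'0 i : (0 <= f' i)%R.
  by rewrite /f'; case: ifPn => // /set_mem Si; rewrite fine_ge0// f0.
have g'0 i : (0 <= g' i)%R.
  by rewrite /g'; case: ifPn => // /set_mem Si; rewrite fine_ge0// g0.
have ff' i : S i -> f i = (EFin \o f') i.
  by move=> Si; rewrite /= /f' mem_set// fineK// ffin.
have gg' i : S i -> g i = (EFin \o g') i.
  by move=> Si; rewrite /= /g' mem_set// fineK// gfin.
rewrite (eq_lnorm r%:E ff') (eq_lnorm r%:E gg').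
rewrite (@eq_lnorm r%:E _ _ (EFin \o (f' \+ g')%R)); last first.
  by move=> i Si; rewrite ff'// gg'.
rewrite !lnormE_Lnorm// => [|i]; last exact: addr_ge0.
apply: le_trans (minkowski_EFin _ _ _ _) => //.
rewrite le_eqVlt; apply/orP; left; apply/eqP; congr Lnorm.
apply/funext => i /=; congr EFin.
by case: ifP; rewrite ?addr0.
Qed.
End LNorm.

(** * Enumerations of diagrams *)

Section Enumerations.
Context {X : Type}.
Implicit Types (m : X -> option nat) (I J : set nat) (x y : nat -> X).

Lemma hascard_card_eq (S S' : set nat) o : hascard S o -> hascard S' o ->
  (S #= S')%card.
Proof.
case: o => [n|] /= Sn S'n; first by rewrite (card_eql Sn) card_eq_sym.
by rewrite card_eq_le; apply/andP; split;
  apply: (card_le_trans (card_leT _)); apply/infiniteP.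
Qed.

Lemma card_eq_hascard (S S' : set nat) o : (S #= S')%card ->
  hascard S o -> hascard S' o.
Proof.
case: o => [n|] SS' /=; first by rewrite (card_eql SS').
by rewrite (eq_finite_set SS').
Qed.

(** Over each point the two fibres have the same cardinality; bijections chosen fibre by fibre glue
    together. *)
Lemma represents_bij m I J x y : represents m I x -> represents m J y ->
  exists2 b, set_bij I J b & forall i, I i -> y (b i) = x i.
Proof.
move=> mIx mJy.
have /choice[b bP] z : exists b : nat -> nat,
    set_bij [set i | I i /\ x i = z] [set j | J j /\ y j = z] b.
  by apply/card_set_bijP; exact: hascard_card_eq (mIx z) (mJy z).
have bJ i : I i -> J (b (x i) i) /\ y (b (x i) i) = x i.
  by move=> Ii; have [f _ _] := bP (x i); apply: (f i).
exists (fun i => b (x i) i); last by move=> i /bJ[].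
split=> [i /bJ[]//|i j /set_mem Ii /set_mem Ij bij|j Jj].
  have xij : x i = x j by rewrite -(bJ i Ii).2 bij (bJ j Ij).2.
  have [_ binj _] := bP (x j).
  by move: bij; rewrite xij => /binj; apply; rewrite inE.
have [_ _ /(_ j (conj Jj erefl))[i [Ii xi] bi]] := bP (y j).
by exists i => //; rewrite xi.
Qed.

(** An index codes a pair: a point of the countable support and a copy number below its
    multiplicity. [x0] is a default for naturals that code no pair. *)
Lemma represents_exists (A : set X) m (x0 : X) : is_dgm A m ->
  exists I x, represents m I x.
Proof.
move=> [_ /countable_injP[g ginj]].
pose below k o := if o is Some n then (k < n)%N else true.
pose code (yk : X * nat) : nat := pickle (g yk.1, yk.2).
pose M := [set yk : X * nat | below yk.2 (m yk.1)].
have M0 yk : M yk -> m yk.1 <> Some 0%N by rewrite /M /= => + mE; rewrite mE.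
have code_inj : set_inj M code.
  move=> [y k] [y' k'] /set_mem My /set_mem My' /(pcan_inj pickleK)[gy kk'].
  congr pair => //; apply: ginj => //; rewrite inE; [exact: M0 My | exact: M0 My'].
have /choice[x xP] i : exists y : X, forall yk, M yk -> code yk = i -> yk.1 = y.
  have [[yk Myk <-]|noM] := pselect (exists2 yk, M yk & code yk = i).
    by exists yk.1 => yk' Myk' /code_inj-> //; rewrite inE.
  by exists x0 => yk Myk yki; exfalso; apply: noM; exists yk.
exists (code @` M), x => y.
have -> : [set i | (code @` M) i /\ x i = y] =
    (fun k => code (y, k)) @` [set k | below k (m y)].
  apply/seteqP; split=> [_ [[[y' k] Myk <-]] xy|_ [k yk <-]] /=.
    have /= y'y := xP _ _ Myk erefl.
    by rewrite -xy -y'y; exists k => //; rewrite -xy -y'y.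
  have Myk : M (y, k) by [].
  by split; [exists (y, k) | rewrite -(xP _ _ Myk erefl)].
have cinj : set_inj [set k | below k (m y)] (fun k => code (y, k)).
  move=> k k' /set_mem Mk /set_mem Mk' cc.
  by have [] := code_inj (y, k) (y, k')
    (mem_set (Mk : M (y, k))) (mem_set (Mk' : M (y, k'))) cc.
apply: card_eq_hascard (card_esym (inj_card_eq cinj)) _.
case: (m y) => [n|] /=; first exact: card_eqxx.
by move=> fin; apply: infinite_nat; apply: sub_finite_set fin.
Qed.

End Enumerations.

(** * Matchings *)

Section Matchings.
Context {R : realType} {X : Type} (d : X -> X -> \bar R) (A : set X).
Variable p : \bar R.
Hypotheses (dm : is_ext_metric d) (p1 : (1 <= p)%E).
Local Open Scope ereal_scope.
Implicit Types (m : X -> option nat).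

Let d_ge0 x y : 0 <= d x y. Proof. by have [] := dm. Qed.
Let dC x y : d x y = d y x. Proof. by have [] := dm. Qed.

Lemma dist_to_ge0 x : 0 <= dist_to d A x.
Proof. by apply: le_ereal_inf_tmp => _ [a _ <-]. Qed.

Lemma dist_to_le x a : A a -> dist_to d A x <= d x a.
Proof. by move=> Aa; apply: ereal_inf_lbound; exists a. Qed.

Lemma dist_to_tri x y : dist_to d A x <= d x y + dist_to d A y.
Proof.
have [_ _ _ tri] := dm.
have [->|dxy] := eqVneq (d x y) +oo.
  by rewrite addye ?leey// gt_eqF// (lt_le_trans _ (dist_to_ge0 y))// ltNyr.
have dfin : d x y \is a fin_num by rewrite ge0_fin_numE ?d_ge0// ltey.
rewrite addeC -leeBlDr//; apply: le_ereal_inf_tmp => _ [a Aa <-].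
rewrite leeBlDr// addeC; apply: le_trans (tri x y a).
exact: dist_to_le.
Qed.

(** Reading a matching backwards replaces [K] by its image, inverts [phi] and exchanges [z] with
    [w]. *)
Lemma matching_costs_sym m1 m2 :
  matching_costs d A p m1 m2 `<=` matching_costs d A p m2 m1.
Proof.
move=> c [I [J [K [x [y [z [w [phi]]]]]]]].
move=> [m1x m2y [KI phi_inj phiJ] [zA wA] ->].
have /choice[psi psiP] j : exists i, (phi @` K) j -> K i /\ phi i = j.
  have [[i Ki <-]|nj] := pselect ((phi @` K) j); first by exists i.
  by exists 0%N => /nj.
have psiK i : K i -> psi (phi i) = i.
  move=> Ki; have [Kp pp] := psiP (phi i) (ex_intro2 _ _ i Ki erefl).
  exact: phi_inj.
have psi_phi : psi @` (phi @` K) = K.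
  apply/seteqP; split=> [_ [_ [i Ki <-] <-]|i Ki]; first by rewrite psiK.
  by exists (phi i); [exists i | exact: psiK].
exists J, I, (phi @` K), y, x, w, z, psi; split => //.
- split=> //; last by rewrite psi_phi.
  by move=> _ _ [i Ki <-] [j Kj <-]; rewrite !psiK// => ->.
- by rewrite psi_phi.
have costK : [set d (y j) (x (psi j)) | j in phi @` K] =
    [set d (x k) (y (phi k)) | k in K].
  rewrite image_comp; apply: eq_imagel => i Ki.
  by rewrite /= psiK// dC.
have costI : [set d (z i) (x i) | i in I `\` K] =
    [set d (x i) (z i) | i in I `\` K].
  by apply: eq_imagel => i _; rewrite dC.
have costJ : [set d (y j) (w j) | j in J `\` phi @` K] =
    [set d (w j) (y j) | j in J `\` phi @` K].
  by apply: eq_imagel => i _; rewrite dC.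
rewrite psi_phi costK costI costJ; move: p => [r||]; last 2 first.
- by rewrite setUAC.
- by rewrite setUAC.
- congr poweR; rewrite esum_image; last first.
    by move=> i j /set_mem Ki /set_mem Kj; exact: phi_inj.
  rewrite -!addeA; congr (_ + _).
    by apply: eq_esum => i Ki; rewrite psiK// dC.
  by rewrite addeC; congr (_ + _); apply: eq_esum => i _; rewrite dC.
Qed.

Lemma Wp_ge0 m1 m2 : 0 <= Wp d A p m1 m2.
Proof.
apply: le_ereal_inf_tmp => c [I [J [K [x [y [z [w [phi [_ _ _ _ ->]]]]]]]]].
case: p => [r||]; first exact: poweR_ge0.
- by apply: ereal_sup_ubound; left; left; left.
- by apply: ereal_sup_ubound; left; left; left.
Qed.

Lemma Wp_sym m1 m2 : Wp d A p m1 m2 = Wp d A p m2 m1.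
Proof. by congr ereal_inf; apply/seteqP; split; exact: matching_costs_sym. Qed.

(** An analogue of the error of best [n]-term approximation. [F] may leave [I]: only [I] minus [F]
    enters the norm. *)
Definition residual_costs (n : nat) m : set (\bar R) :=
  [set c | exists (I : set nat) (x : nat -> X) (F : set nat),
    [/\ represents m I x, (F #<= `I_n)%card &
        c = lnorm p (I `\` F) (fun i => dist_to d A (x i))]].

(* The distance, up to matching, to the diagrams with at most [n] points. *)
Definition residual (n : nat) m : \bar R := ereal_inf (residual_costs n m).

Lemma residual_ge0 n m : 0 <= residual n m.
Proof. by apply: le_ereal_inf_tmp => _ [I [x [F [_ _ ->]]]]; exact: lnorm_ge0. Qed.

Lemma residual_anti n n' m : (n <= n')%N -> residual n' m <= residual n m.
Proof.
move=> nn'; apply: ereal_inf_le_tmp => c [I [x [F [mI Fn ->]]]].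
by exists I, x, F; split => //; apply: (card_le_trans Fn); rewrite card_le_II.
Qed.

(** From [m1], remove the points matched with removed points of [m2]; injectivity of the matching
    bounds their number by [n]. For the others, use the triangle inequality through the partner,
    then Minkowski's inequality. *)
Lemma residual_cost n m1 m2 c c' : matching_costs d A p m1 m2 c ->
  residual_costs n m2 c' ->
  residual n m1 <= c + c'.
Proof.
move=> [I [J [K [x [y [z [w [phi]]]]]]]].
move=> [m1x m2y [KI phi_inj phiJ] [zA wA] cE].
move=> [J' [y' [F' [m2y' F'n ->]]]].
(* The matching and the residual may enumerate [m2] differently; [b] translates between the two. *)
have [b [bJ b_inj _] by'] := represents_bij m2y m2y'.
pose F := [set i | K i /\ F' (b (phi i))].
have bphi_inj : set_inj K (b \o phi).
  move=> i j /set_mem Ki /set_mem Kj /b_inj bij; apply: phi_inj => //.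
  by apply: bij; rewrite inE; apply: phiJ; [exists i | exists j].
have Fn : (F #<= `I_n)%card.
  apply: card_le_trans F'n.
  have FK : {in F &, injective (b \o phi)}.
    by move=> i j /set_mem[Ki _] /set_mem[Kj _]; apply: bphi_inj; rewrite inE.
  rewrite -(card_le_eql (inj_card_eq FK)); apply: subset_card_le.
  by move=> _ [i [_ Fi] <-].
(* [v i] is what the matching pays at [i]; [u i] is the distance from the partner of [i] to [A], or
   0 if [i] is sent to [A]. *)
pose u i := if i \in K then dist_to d A (y (phi i)) else 0.
pose v i := if i \in K then d (x i) (y (phi i)) else d (x i) (z i).
have u0 i : 0 <= u i by rewrite /u; case: ifP => // _; exact: dist_to_ge0.
have v0 i : 0 <= v i by rewrite /v; case: ifP.
apply: (@le_trans _ _ (lnorm p (I `\` F) (fun i => dist_to d A (x i)))).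
  by apply: ereal_inf_lbound; exists I, x, F.
apply: (@le_trans _ _ (lnorm p (I `\` F) (fun i => v i + u i))).
  apply: le_lnorm => // i => [[Ii Fi]|_]; last exact: adde_ge0.
  rewrite dist_to_ge0 /u /v; case: ifPn => [_|/negP iK]; first exact: dist_to_tri.
  by rewrite adde0 dist_to_le//; apply: zA; split=> // /mem_set.
apply: le_trans (lnormD _ _ _) _ => //; apply: leeD.
  (* The cost [c] dominates the norm of [v], since it also counts the unmatched points of [m2]. *)
  apply: (@le_trans _ _ (lnorm p I v)).
    by apply: le_lnorm => // i _; rewrite v0 lexx.
  rewrite cE; have IK : I `&` K = K by apply/setIidr.
  have vK i : K i -> d (x i) (y (phi i)) = v i by move=> Ki; rewrite /v mem_set.
  have vIK i : (I `\` K) i -> d (x i) (z i) = v i.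
    by move=> [_ iK]; rewrite /v memNset.
  case: p p1 => [r||]// r1 /=; last first.
    apply: ge_ereal_sup => _ [->|[i Ii <-]]; apply: ereal_sup_ubound.
      by left; left; left.
    have [Ki|nKi] := pselect (K i).
      by left; left; right; exists i => //; rewrite vK.
    by left; right; exists i => //; rewrite vIK.
  have r0 : (0 < r)%R by rewrite -lte_fin (lt_le_trans lte01).
  apply: le_poweR; rewrite ?invr_gt0//.
    by apply: esum_ge0 => *; exact: poweR_ge0.
  rewrite (esumID K) => [|i _]; last exact: poweR_ge0.
  rewrite IK -[leLHS]adde0; apply: leeD.
    rewrite le_eqVlt; apply/orP; left; apply/eqP.
    congr (_ + _); apply: eq_esum => i Ki.
      by rewrite vK.
    by rewrite vIK.
  by apply: esum_ge0 => *; exact: poweR_ge0.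
(* [u] vanishes off [K], and [b \o phi] sends the kept indices of [K] injectively to kept indices of
   [J']. *)
apply: (@le_trans _ _ (lnorm p ((I `\` F) `&` K) u)).
  by apply: lnorm_supp => // i _ nKi; rewrite /u memNset.
apply: (@le_trans _ _ (lnorm p ((I `\` F) `&` K)
    ((fun j => dist_to d A (y' j)) \o (b \o phi)))).
  apply: le_lnorm => // i; last by move=> _; exact: dist_to_ge0.
  move=> [[Ii Fi] Ki]; rewrite u0 /u mem_set//= by'//.
  by apply: phiJ; exists i.
rewrite -lnorm_image; last first.
  move=> i j /set_mem[_ Ki] /set_mem[_ Kj] ?.
  by apply: bphi_inj => //; rewrite inE.
apply: le_lnorm => //; first last.
- by move=> *; exact: dist_to_ge0.
- by move=> *; rewrite dist_to_ge0 lexx.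
move=> _ [i [[Ii Fi] Ki] <-]; split; first by apply: bJ; apply: phiJ; exists i.
by move=> F'i; apply: Fi.
Qed.

(** A matching and a removal, each within [e / 2] of its infimum, are combined by [residual_cost];
    infinite terms on the right are trivial. *)
Lemma residual_Lipschitz n m1 m2 :
  residual n m1 <= Wp d A p m1 m2 + residual n m2.
Proof.
apply/lee_addgt0Pr => e e0.
have e20 : (0 < e / 2)%R by rewrite divr_gt0.
have Wp_ge0 := Wp_ge0 m1 m2.
have [->|Wfin] := eqVneq (Wp d A p m1 m2) +oo.
  by rewrite !addye ?leey// gt_eqF// (lt_le_trans _ (residual_ge0 n m2))// ltNyr.
have [->|rfin] := eqVneq (residual n m2) +oo.
  by rewrite !addey ?leey// gt_eqF// (lt_le_trans _ Wp_ge0)// ltNyr.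
have [|c mc cW] := @lb_ereal_inf_adherent _ (matching_costs d A p m1 m2) _ e20.
  by rewrite ge0_fin_numE ?ltey.
have [|c' mc' cr] :=
  @lb_ereal_inf_adherent _ _ _ e20 (_ : residual n m2 \is a fin_num).
  by rewrite ge0_fin_numE ?ltey// residual_ge0.
apply: (le_trans (residual_cost mc mc')).
rewrite [e in e%:E]splitr EFinD addeACA.
by apply: leeD; exact: ltW.
Qed.

End Matchings.

(** * Multiples of a point *)

Section ConstantSums.
Context {R : realType}.
Local Open Scope ereal_scope.

Lemma esum_cst (S : set nat) (n : nat) (a : R) : (0 <= a)%R ->
  (S #= `I_n)%card -> \esum_(i in S) a%:E = (n%:R * a)%:E.
Proof.
move=> a0; rewrite card_eq_sym => /card_set_bijP[b bS].
rewrite (reindex_esum _ _ _ _ bS) esum_fset; last 2 first.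
- exact: finite_II.
- by move=> *; rewrite lee_fin.
rewrite -(@fsbig_ord _ _ _ n (fun=> a%:E)) sumEFin sumr_const card_ord.
by rewrite mulr_natl.
Qed.

Lemma esum_cst_le (S : set nat) (n : nat) (a : R) : (0 <= a)%R ->
  (S #<= `I_n)%card -> \esum_(i in S) a%:E <= (n%:R * a)%:E.
Proof.
move=> a0 Sn; have : finite_set S by apply: card_le_finite Sn (finite_II n).
move=> [k Sk]; rewrite (esum_cst a0 Sk) lee_fin ler_wpM2r// ler_nat.
by rewrite -card_le_II -(card_le_eql Sk).
Qed.

(** At least [k] terms survive: split the sum along [F] and cancel the finite number [n * a]. *)
Lemma esum_cst_setD (S F : set nat) (k n : nat) (a : R) : (0 <= a)%R ->
  (S #= `I_(n + k))%card -> (F #<= `I_n)%card ->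
  (k%:R * a)%:E <= \esum_(i in S `\` F) a%:E.
Proof.
move=> a0 Snk Fn; have := esum_cst a0 Snk.
rewrite (esumID F) => [E|i _]; last by rewrite lee_fin.
have SF : \esum_(i in S `&` F) a%:E <= (n%:R * a)%:E.
  by apply: esum_cst_le => //; apply: card_le_trans Fn; exact: subset_card_le.
have : (n%:R * a)%:E + (k%:R * a)%:E <=
    (n%:R * a)%:E + \esum_(i in S `\` F) a%:E.
  by rewrite -EFinD -mulrDl -natrD -E leeD2r.
by rewrite leeD2lE.
Qed.

End ConstantSums.

Section Multiples.
Context {R : realType} {X : Type} (d : X -> X -> \bar R) (A : set X).
Hypothesis dm : is_ext_metric d.

Definition multiple (x : X) (M : nat) : X -> option nat :=
  fun y => if `[< y = x >] then Some M else Some 0%N.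

Lemma multiple_dgm x M : ~ A x -> is_dgm A (multiple x M).
Proof.
move=> Ax; split=> [y Ay|].
  by rewrite /multiple; case: asboolP => // yx; move: Ay; rewrite yx.
apply: (sub_countable _ (countable1 x)); apply: subset_card_le => y /=.
by rewrite /multiple; case: asboolP => [->|].
Qed.

Lemma multiple_total_finite x M : total_finite (multiple x M).
Proof.
split=> [|y]; last by rewrite /multiple; case: asboolP.
apply: sub_finite_set (finite_set1 x) => y /=.
by rewrite /multiple; case: asboolP => [->|].
Qed.

Lemma multiple_represents x M : represents (multiple x M) `I_M (fun=> x).
Proof.
move=> y; rewrite /multiple; case: asboolP => [->|yx] /=.
  rewrite (_ : [set _ | _] = `I_M) ?card_eqxx//.
  by apply/seteqP; split=> i //= [].
rewrite (_ : [set _ | _] = set0); first by rewrite II0 card_eqxx.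
by apply/seteqP; split=> i //= [_ /esym].
Qed.

Lemma represents_multiple x M I u : represents (multiple x M) I u ->
  (I #= `I_M)%card /\ forall i, I i -> u i = x.
Proof.
move=> Iu; have Ix i : I i -> u i = x.
  move=> Ii; apply: contrapT => uix; have := Iu (u i).
  rewrite /multiple; case: asboolP => //= _; rewrite II0 card_eq0 => /eqP E.
  by have : set0 i by rewrite -E.
split=> //; have := Iu x; rewrite /multiple; case: asboolP => //= _.
rewrite (_ : [set _ | _] = I)//; apply/seteqP; split=> i /=; first by case.
by move=> Ii; split => //; exact: Ix.
Qed.

Lemma zero_represents (u : nat -> X) : represents (@zero_dgm X) set0 u.
Proof.
move=> y /=; rewrite (_ : [set _ | _] = set0) ?II0 ?card_eqxx//.
by apply/seteqP; split=> i //= [].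
Qed.

Lemma zero_is_dgm : is_dgm A (@zero_dgm X).
Proof.
split=> //; rewrite (_ : [set _ | _] = set0); first exact: countable0.
by apply/seteqP; split.
Qed.

Lemma zero_total_finite : total_finite (@zero_dgm X).
Proof.
split=> //; rewrite (_ : [set _ | _] = set0); first exact: finite_set0.
by apply/seteqP; split.
Qed.

Lemma Wp_multiple p x M z : (1 <= p)%E -> A z ->
  (Wp d A p (@zero_dgm X) (multiple x M) <= lnorm p `I_M (fun=> d z x))%E.
Proof.
move=> p1 Az; apply: ereal_inf_lbound.
exists set0, `I_M, set0, (fun=> x), (fun=> x), (fun=> z), (fun=> z), id.
split => //.
- exact: zero_represents.
- exact: multiple_represents.
- by split => //; rewrite image_set0.
- rewrite set0D !image_set0 setD0 !setU0 /lnorm.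
  by move: p p1 => [r||] //; rewrite !esum_set0 !add0e.
Qed.

(** Without such a point the [e]-thickening of [A] would be [A] itself; closedness makes the
    distance positive off [A]. *)
Lemma nonisolated_close (e : R) : dclosed d A -> ~ isolated_pair d A ->
  0 < e -> exists x (a : R), [/\ ~ A x, dist_to d A x = a%:E & 0 < a < e].
Proof.
move=> Acl Aiso e0; have [[x [xe Ax]]|nox] :=
    pselect (exists x, (dist_to d A x < e%:E)%E /\ ~ A x).
  have xfin : dist_to d A x \is a fin_num.
    by rewrite ge0_fin_numE ?dist_to_ge0// (lt_trans xe)// ltey.
  exists x, (fine (dist_to d A x)); rewrite fineK//; split => //.
  rewrite -!lte_fin fineK// xe andbT lt_def dist_to_ge0// andbT.
  by apply/eqP => /Acl.
exfalso; apply: Aiso; exists e%:E; split; first by rewrite lte_fin.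
apply/seteqP; split=> x; rewrite /thicken /=.
  by move=> xe; apply: contrapT => Ax; apply: nox; exists x.
move=> Ax; apply: (@le_lt_trans _ _ 0%E); last by rewrite lte_fin.
by have [_ dxx _ _] := dm; rewrite -(dxx x); exact: dist_to_le.
Qed.

(** Every enumeration of a multiple is constant, so only the number of copies left after the removal
    matters. *)
Lemma residual_multiple p n k x (a c : R) : (1 <= p)%E ->
  dist_to d A x = a%:E ->
  (forall S : set nat, (exists2 I, (I #= `I_(n + k))%card &
     exists2 F, (F #<= `I_n)%card & S = I `\` F) ->
     (c%:E <= lnorm p S (fun=> a%:E))%E) ->
  (c%:E <= residual d A p n (multiple x (n + k)))%E.
Proof.
move=> p1 xa cS; apply: le_ereal_inf_tmp => _ [I [u [F [Iu Fn ->]]]].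
have [In Ix] := represents_multiple Iu.
rewrite (@eq_lnorm _ _ _ _ (fun=> a%:E)); last by move=> i [/Ix -> _].
by apply: cS; exists I => //; exists F.
Qed.

(** It is essential that [c] precedes [n]: Dini's argument produces [n] from [c], and the diagram is
    chosen last. The finite distance to [A] will put the multiples in [Dbar]. *)
Lemma multiple_far p (e : R) : (1 <= p)%E -> dclosed d A ->
  ~ isolated_pair d A -> 0 < e -> exists2 c : R, 0 < c &
  forall n, exists x M, [/\ ~ A x, (dist_to d A x < +oo)%E,
    (Wp d A p (@zero_dgm X) (multiple x M) < e%:E)%E &
    (c%:E <= residual d A p n (multiple x M))%E].
Proof.
move=> p1 Acl Aiso e0.
have dC x y : d x y = d y x by have [] := dm.
case: p p1 => [r||]// p1; last first.
  (* For [p = +oo] one point near [A] serves every [n]: of its [n + 1] copies at least one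
     survives. *)
  have [x [a [Ax xa /andP[a0 ae]]]] := nonisolated_close Acl Aiso e0.
  have [|_ [z Az <-] xz] := @ereal_inf_lt _ [set d x z | z in A] e%:E.
    by rewrite -/(dist_to d A x) xa lte_fin.
  exists a => // n; exists x, (n + 1)%N; split => //; first by rewrite xa ltey.
    apply: (le_lt_trans (Wp_multiple x (n + 1) p1 Az)).
    apply: (@le_lt_trans _ _ (d x z)) => //.
    apply: ge_ereal_sup => _ [->|[i _ <-]]; last by rewrite dC.
    by have [] := dm.
  apply: (residual_multiple p1 xa) => _ [I In [F Fn ->]].
  have [[i IFi]|noi] := pselect (exists i, (I `\` F) i).
    by apply: ereal_sup_ubound; right; exists i.
  have : (I #<= F)%card.
    apply: subset_card_le => i Ii; apply: contrapT => nFi.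
    by apply: noi; exists i.
  move=> /card_le_trans/(_ Fn); rewrite (card_le_eql In) card_le_II.
  by rewrite addn1 ltnn.
have r0 : 0 < r by rewrite -lte_fin (lt_le_trans lte01).
have rK (x : R) : 0 <= x -> (x `^ r) `^ r^-1 = x.
  by move=> x0; rewrite -powRrM mulfV ?gt_eqF// powRr1.
(* The distance to the zero diagram will be at most [4 * c = e / 2]. *)
pose c := e / 8; have c0 : 0 < c by rewrite divr_gt0.
exists c => // n.
have cn0 : 0 < c / n.+1%:R by rewrite divr_gt0.
(* With [a < c / (n + 1)], even [n + 1] additional copies weigh at most [c^r] in the sum of [r]-th
   powers. *)
have [x [a [Ax xa /andP[a0 ac]]]] := nonisolated_close Acl Aiso cn0.
have [|_ [z Az <-] xz] := @ereal_inf_lt _ [set d x z | z in A] (2 * a)%:E.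
  by rewrite -/(dist_to d A x) xa lte_fin ltr_pMl// ltr1n.
have r0' := ltW r0; have a0' := ltW a0; have c0' := ltW c0.
(* [k] copies bring the sum of [r]-th powers to at least [c^r], exceeding it by at most [a^r]; [n]
   further copies compensate for the removal. *)
pose k := (Num.truncn ((c / a) `^ r)).+1.
have ar0 : 0 <= a `^ r by exact: powR_ge0.
have ca : c `^ r = (c / a) `^ r * a `^ r.
  by rewrite -powRM ?divr_ge0 ?ltW// divfK ?gt_eqF.
have kl : c `^ r <= k%:R * a `^ r.
  by rewrite ca ler_wpM2r// ltW// truncnS_gt.
have ku : k%:R * a `^ r <= c `^ r + a `^ r.
  rewrite ca /k -natr1 mulrDl mul1r lerD2r ler_wpM2r//.
  by rewrite truncn_le// powR_ge0.
have na : n.+1%:R * a `^ r <= c `^ r.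
  apply: (@le_trans _ _ (n.+1%:R `^ r * a `^ r)).
    rewrite ler_wpM2r// -[leLHS]powRr1//; apply: ler_powR; first by rewrite ler1n.
    by rewrite -lee_fin.
  rewrite -powRM//; apply: ge0_ler_powR => //; rewrite ?nnegrE ?mulr_ge0//.
  by rewrite mulrC -ler_pdivlMr// ltW.
(* Here [(n + k) a^r <= (n + 1) a^r + c^r <= 2 c^r <= 2^r c^r]; the other factor [2^r] comes from
   taking [z] at distance below [2 * a]. *)
have Mle : (n + k)%:R * (2 * a) `^ r <= (4 * c) `^ r.
  rewrite (_ : 4 = 2 * 2 :> R); last by rewrite -natrM.
  rewrite -mulrA (powRM _ (_ : 0 <= 2) (mulr_ge0 _ c0'))// (powRM _ _ c0')//.
  rewrite (powRM _ _ a0')//.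
  rewrite mulrCA ler_wpM2l ?powR_ge0//.
  apply: (@le_trans _ _ (2 * c `^ r)).
    rewrite natrD mulrDl (le_trans (lerD (lexx _) ku))//.
    by move: na; rewrite -natr1 mulrDl mul1r; lra.
  by rewrite ler_wpM2r ?powR_ge0// -[leLHS]powRr1// ler_powR// ?ler1n// -lee_fin.
exists x, (n + k)%N; split => //; first by rewrite xa ltey.
- apply: (le_lt_trans (Wp_multiple x (n + k) p1 Az)).
  apply: (@le_lt_trans _ _ (4 * c)%:E); last by rewrite lte_fin /c; lra.
  apply: (@le_trans _ _ (lnorm r%:E `I_(n + k) (fun=> (2 * a)%:E))).
    apply: le_lnorm => // [i _|_ _]; last by rewrite lee_fin mulr_ge0// ltW.
    by apply/andP; split; [have [] := dm | rewrite dC; exact: ltW].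
  rewrite /lnorm poweR_EFin (@esum_cst _ _ (n + k))//; last by rewrite powR_ge0.
  rewrite poweR_EFin lee_fin.
  rewrite -[leRHS]rK; last by rewrite mulr_ge0// ltW.
  apply: ge0_ler_powR => //; rewrite ?nnegrE ?powR_ge0//.
    by rewrite invr_ge0 ltW.
  by rewrite mulr_ge0// powR_ge0.
- apply: (residual_multiple p1 xa) => _ [I In [F Fn ->]].
  have := esum_cst_setD ar0 In Fn; rewrite /lnorm poweR_EFin => kS.
  rewrite (_ : c%:E = poweR (c `^ r)%:E r^-1); last by rewrite poweR_EFin rK.
  apply: le_poweR; rewrite ?invr_gt0// ?lee_fin ?powR_ge0//.
  by apply: le_trans kS; rewrite lee_fin.
Qed.

End Multiples.

(** * Vanishing of the residuals *)

(** A finite partial sum within [e] of the finite total leaves a tail of at most [e]. *)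
Lemma esum_tail {R : realType} (S : set nat) (a : nat -> \bar R) (e : R) :
  (forall i, 0 <= a i)%E -> (\esum_(i in S) a i < +oo)%E -> 0 < e ->
  exists2 F, finite_set F & (\esum_(i in S `\` F) a i <= e%:E)%E.
Proof.
move=> a0 afin e0.
have sfin : (\esum_(i in S) a i \is a fin_num)%E.
  by rewrite ge0_fin_numE ?esum_ge0.
have [_ [F [finF FS] <-] Fe] := ub_ereal_sup_adherent e0 sfin.
exists F => //; have := esumID F S a (fun i _ => a0 i).
rewrite setIidr// -setDE [X in (_ = X + _)%E]esum_fset// => E.
have Ffin : (\sum_(i \in F) a i \is a fin_num)%E.
  rewrite ge0_fin_numE; last by apply: fsume_ge0.
  by apply: le_lt_trans afin; rewrite [leRHS]E leeDl// esum_ge0.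
move: Fe; rewrite -[X in (X - _)%E]/(\esum_(i in S) a i)%E E.
rewrite lteBlDr// lteD2lE// => /ltW.
exact.
Qed.

Section ResidualVanishes.
Context {R : realType} {X : Type} (d : X -> X -> \bar R) (A : set X).
Hypothesis dm : is_ext_metric d.
Local Open Scope ereal_scope.

Lemma represents_restr (S : set X) m I u : represents m I u ->
  represents (restr S m) [set i | I i /\ S (u i)] u.
Proof.
move=> Iu y; rewrite /restr; case: asboolP => Sy.
  have -> : [set i | [set i | I i /\ S (u i)] i /\ u i = y] =
      [set i | I i /\ u i = y].
    by apply/seteqP; split=> i /= [] => [[]//|Ii uy]; rewrite uy.
  exact: Iu.
rewrite /= (_ : [set _ | _] = set0) ?II0 ?card_eqxx//.
by apply/seteqP; split=> i //= [[_ Su] uy]; rewrite uy in Su.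
Qed.

Lemma represents_total_finite (m : X -> option nat) I u : represents m I u ->
  total_finite m -> finite_set I.
Proof.
move=> Iu [suppfin mfin].
have -> : I = \bigcup_(y in [set y | m y <> Some 0%N]) [set i | I i /\ u i = y].
  apply/seteqP; split=> [i Ii|i [y _] []//]; exists (u i) => //= mui.
  have := Iu (u i); rewrite mui /= II0 card_eq0 => /eqP E.
  by have : set0 i by rewrite -E.
apply: bigcup_finite => // y _.
case my: (m y) => [k|]; last by have := mfin y my.
by have := Iu y; rewrite my /= => Ik; exists k.
Qed.

Lemma residual_le p n (m : X -> option nat) I u F : represents m I u ->
  (F #<= `I_n)%card ->
  residual d A p n m <= lnorm p (I `\` F) (fun i => dist_to d A (u i)).
Proof. by move=> mI Fn; apply: ereal_inf_lbound; exists I, u, F. Qed.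

Lemma finite_set_card_le (F : set nat) : finite_set F ->
  exists n, (F #<= `I_n)%card.
Proof. by move=> [n Fn]; exists n; rewrite (card_le_eql Fn) card_lexx. Qed.

Lemma lnorm_set0 p (f : nat -> \bar R) : 1 <= p -> lnorm p set0 f = 0.
Proof.
case: p => [r||]// p1 /=; last by rewrite image_set0 setU0 ereal_sup1.
rewrite esum_set0 poweR0r// invr_eq0 gt_eqF//.
by rewrite -lte_fin (lt_le_trans lte01).
Qed.

Lemma total_finite_residual p (x0 : X) m : 1 <= p -> is_dgm A m ->
  total_finite m -> exists n, residual d A p n m <= 0.
Proof.
move=> p1 mdgm mfin; have [I [u Iu]] := represents_exists x0 mdgm.
have [n In] := finite_set_card_le (represents_total_finite Iu mfin).
by exists n; rewrite (le_trans (residual_le _ Iu In))// setDv lnorm_set0.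
Qed.

Lemma Dfin_residual p (x0 : X) (a : DgmW d A p) (e : R) : 1 <= p ->
  Dfin d A p a -> (0 < e)%R ->
  exists n, residual d A p n (sval (a : Dgm A)) < e%:E.
Proof.
move=> p1 afin e0; have [n an] := total_finite_residual x0 p1 (svalP a) afin.
by exists n; rewrite (le_lt_trans an)// lte_fin.
Qed.

(** For [p = +oo], remove the finitely many points at distance at least [e / 2] from [A]. For finite
    [p], remove the finitely many points at infinite distance, then enough others to make the tail
    of a convergent sum small. *)
Lemma Dbar_residual p (x0 : X) (a : DgmW d A p) (e : R) : 1 <= p ->
  Dbar d A p a -> (0 < e)%R ->
  exists n, residual d A p n (sval (a : Dgm A)) < e%:E.
Proof.
move=> p1; have [I [u Iu]] := represents_exists x0 (svalP (a : Dgm A)).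
have Ifin (S : set X) : total_finite (restr S (sval (a : Dgm A))) ->
    finite_set [set i | I i /\ S (u i)].
  exact: represents_total_finite (represents_restr S Iu).
have e20 : (0 < e -> 0 < e / 2)%R by move=> e0; rewrite divr_gt0.
have e2e : (0 < e -> e / 2 < e)%R.
  by move=> e0; rewrite gtr_pMr// invf_lt1// ltr1n.
case: p p1 a I u Iu Ifin => [r||]// p1 a I u Iu Ifin; last first.
  move=> afin e0.
  have /Ifin/finite_set_card_le[n Fn] := afin (e / 2)%:E (e20 e0).
  exists n; apply: (le_lt_trans (residual_le _ Iu Fn)).
  apply: (@le_lt_trans _ _ (e / 2)%:E); last by rewrite lte_fin e2e.
  apply: ge_ereal_sup => _ [->|[i [Ii nF] <-]].
    by rewrite lee_fin ltW// e20.
  rewrite leNgt; apply/negP => ei; apply: nF; split => //.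
  by rewrite /thicken /= => /(lt_trans ei); rewrite ltxx.
move=> [/Ifin F1fin lfin] e0.
have r0 : (0 < r)%R by rewrite -lte_fin (lt_le_trans lte01).
have uA i : I i -> ~ A (u i).
  move=> Ii Aui; have := Iu (u i); rewrite (svalP (a : Dgm A)).1//= II0 card_eq0.
  by move=> /eqP E; have : set0 i by rewrite -E.
pose I' := [set i | I i /\ (thicken d A +oo `\` A) (u i)].
have I'u : represents (l_part d A +oo (sval (a : Dgm A))) I' u.
  exact: represents_restr.
(* With [n = 0] nothing is removed, so this concerns the norm of all distances to [A]; comparison
   with the zero diagram makes it finite. *)
have : residual d A r%:E 0 (l_part d A +oo (sval (a : Dgm A))) < +oo.
  apply: (le_lt_trans (@residual_Lipschitz _ _ _ A _ dm p1 0 _ (@zero_dgm X))).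
  rewrite lte_add_pinfty//; apply: (@le_lt_trans _ _ 0); last by rewrite ltey.
  have := residual_le r%:E (zero_represents u) (card_lexx `I_0).
  by rewrite set0D lnorm_set0.
move=> /ereal_inf_lt[_ [J [v [F [Jv + ->]]]]].
rewrite II0 card_le0 => /eqP -> {F}; rewrite setD0 => Jfin.
(* The norm is known to be finite for some enumeration [v]; [b] carries this over to [u]. *)
have [b [bI b_inj b_surj] ub] := represents_bij I'u Jv.
have I'fin : lnorm r%:E I' (fun i => dist_to d A (u i)) < +oo.
  rewrite (@eq_lnorm _ r%:E _ _ ((fun j => dist_to d A (v j)) \o b)); last first.
    by move=> i I'i /=; rewrite ub.
  rewrite -lnorm_image//; apply: le_lt_trans Jfin; apply: le_lnorm => //.
  - by move=> _ [i Ii <-]; exact: bI.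
  - by move=> i _; rewrite dist_to_ge0// lexx.
  - by move=> i _; exact: dist_to_ge0.
have e2r : (0 < (e / 2) `^ r)%R by rewrite powR_gt0// e20.
have [|F2 F2fin F2e] := @esum_tail _ I' (fun i => poweR (dist_to d A (u i)) r) _
  (fun i => poweR_ge0 _ _) _ e2r.
  by move: I'fin => /lty_poweRy; apply; rewrite invr_eq0 gt_eqF.
set F1 := [set i | _] in F1fin.
(* [F1] indexes the points at infinite distance from [A]; [F2] carries all but [(e / 2)^r] of the
   remaining sum. *)
have /finite_set_card_le[n Fn] : finite_set (F1 `|` F2) by rewrite finite_setU.
exists n; apply: (le_lt_trans (residual_le _ Iu Fn)).
apply: (@le_lt_trans _ _ (e / 2)%:E); last by rewrite lte_fin e2e.
have -> : (e / 2)%:E = poweR ((e / 2) `^ r)%:E r^-1.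
  by rewrite poweR_EFin -powRrM mulfV ?gt_eqF// powRr1// ltW// e20.
have -> : I `\` (F1 `|` F2) = I' `\` F2.
  apply/seteqP; split=> i [].
    move=> Ii /not_orP[nF1 nF2]; split => //; split => //; split; last exact: uA.
    by apply: contrapT => nth; apply: nF1.
  move=> [Ii [th _]] nF2; split => // -[[_ nth]|//]; exact: nth.
apply: le_poweR => //; first by rewrite invr_gt0.
by apply: esum_ge0 => *; exact: poweR_ge0.
Qed.

End ResidualVanishes.

(** * Function spaces over diagrams *)

Lemma dtop_continuous {T : Type} {R : realType} (dist : T -> T -> \bar R)
    (f : dtop dist -> R) :
  (forall (a b : T) (e : R), (dist a b < e%:E)%E -> `|f a - f b| < e) ->
  continuous f.
Proof.
move=> fdist; apply/continuousP => U oU; suff : dist_open dist (f @^-1` U) by [].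
move=> a Ufa.
have /nbhs_ballP[e /= e0 eU] : nbhs (f a) U by apply: open_nbhs_nbhs.
by exists e => // b /= ab; apply: eU; exact: fdist.
Qed.

Section DiagramFunctionSpaces.
Context {R : realType} {X : Type} (d : X -> X -> \bar R) (A : set X).
Context (p : \bar R) (Y : topologicalType).
Hypotheses (dm : is_ext_metric d) (p1 : (1 <= p)%E).

(** The residual may be infinite; cutting it off at [c] makes it real-valued and keeps the Lipschitz
    bound. *)
Definition truncated_residual (c : R) n (a : Dgm A) : R :=
  fine (mine (residual d A p n (sval a)) c%:E).

Lemma truncated_residualE c n a : 0 <= c ->
  (truncated_residual c n a)%:E = mine (residual d A p n (sval a)) c%:E.
Proof.
move=> c0; rewrite fineK// ge0_fin_numE; first by rewrite gt_min (ltry c) orbT.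
by rewrite le_min residual_ge0// lee_fin.
Qed.

Lemma truncated_residual_continuous c n : 0 <= c ->
  continuous (truncated_residual c n : DgmW d A p -> R).
Proof.
move=> c0; apply: dtop_continuous.
have half (a b : Dgm A) (e : R) : (Wp d A p (sval a) (sval b) < e%:E)%E ->
    truncated_residual c n a - truncated_residual c n b < e.
  move=> abe; have := residual_Lipschitz A dm p1 n (sval a) (sval b).
  move=> lip; rewrite ltrBlDr -lte_fin EFinD !truncated_residualE//.
  have e0 : (0 < e%:E)%E by apply: le_lt_trans abe; exact: Wp_ge0.
  have [bc|cb] := leP (residual d A p n (sval b)) c%:E.
    have bfin : (residual d A p n (sval b) \is a fin_num)%E.
      by rewrite ge0_fin_numE ?residual_ge0// (le_lt_trans bc)// ltey.
    rewrite gt_min; apply/orP; left; apply: (le_lt_trans lip).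
    by rewrite lteD2rE.
  rewrite gt_min; apply/orP; right.
  by rewrite -EFinD lte_fin ltrDr -lte_fin.
move=> a b e ab; rewrite ltr_norml half// andbT ltrNl opprB.
by apply: half; rewrite Wp_sym.
Qed.

Definition zeroD : Dgm A := exist (is_dgm A) _ (zero_is_dgm A).

Definition multipleD x M (Ax : ~ A x) : Dgm A :=
  exist (is_dgm A) _ (multiple_dgm M Ax).

(** A common treatment of both diagram spaces: vanishing residuals feed Dini's argument on compact
    sets, and [E] contains the zero diagram together with the multiples that approach it. *)
Lemma diagram_Cco_not_metrizable (E : set (DgmW d A p)) :
  dclosed d A -> ~ isolated_pair d A -> has_nontrivial_path R Y ->
  (forall a, E a -> forall e : R, 0 < e ->
     exists n, (residual d A p n (sval (a : Dgm A)) < e%:E)%E) ->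
  E zeroD ->
  (forall x M (Ax : ~ A x), (dist_to d A x < +oo)%E -> E (multipleD M Ax)) ->
  ~ metrizable R (Cco (set_type E) Y).
Proof.
move=> Acl Aiso path Evan E0 Emul.
pose z : set_type E := exist (fun a => a \in E) _ (mem_set E0).
pose toD : set_type E -> DgmW d A p := set_val.
pose B n := [set a : set_type E |
  (Wp d A p (@zero_dgm X) (sval (toD a)) < (n.+1%:R^-1 : R)%:E)%E].
apply: (@Cco_not_metrizable R _ _ z B) => //.
  move=> u uB U [_ [[V oV <-] /= Vz VU]].
  have [e e0 eV] := oV _ Vz.
  exists (Num.truncn e^-1) => // n /= nN; apply: VU => /=; apply: eV => /=.
  apply: lt_trans (uB n) _; rewrite lte_fin invf_plt ?posrE//.
  by apply: (lt_le_trans (truncnS_gt _)); rewrite ler_nat.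
move=> K n cK.
have n0 : 0 < n.+1%:R^-1 :> R by rewrite invr_gt0.
have [c c0 far] := multiple_far dm p1 Acl Aiso n0.
have cg k : continuous (truncated_residual c k \o toD : set_type E -> R).
  move=> a; apply: (@continuous_comp _ _ _ toD).
    exact: (@initial_continuous _ _ set_val).
  by apply: truncated_residual_continuous; exact: ltW.
have c0' := ltW c0; have c20 : 0 < c / 2 by rewrite divr_gt0.
have c2c : c / 2 < c by rewrite gtr_pMr// invf_lt1// ltr1n.
(* Dini's argument: near each point of [K] some truncated residual is below [c / 2], later ones are
   no larger, and compactness makes the index uniform. *)
have [k Kk] : exists k, K `<=` [set a | truncated_residual c k (toD a) < c / 2].
  have /compact_near_coveringP/(_ nat \oo
    (fun k a => truncated_residual c k (toD a) < c / 2)) := cK.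
  move=> /(_ _); case; last first.
    by move=> k _ kK; exists k; apply: kK => /=.
  move=> a Ka; have [k ak] := Evan _ (set_valP a) _ c20.
  exists ([set b | truncated_residual c k (toD b) < c / 2], [set l | (k <= l)%N]).
    split => /=; last by exists k.
    apply: open_nbhs_nbhs; split; last first.
      by rewrite /= -lte_fin truncated_residualE// gt_min ak.
    have /continuousP/(_ [set t | t < c / 2]) := cg k.
    by apply; exact: open_lt.
  move=> [b l] [/= bk kl]; apply: le_lt_trans bk.
  rewrite -lee_fin !truncated_residualE//.
  by rewrite le_min2// residual_anti.
have [x [M [Ax xfin xW xr]]] := far k.
pose alpha : set_type E := exist (fun a => a \in E) _ (mem_set (Emul x M Ax xfin)).
(* The affine map sends [c / 2] to 0 and [c] to 1; the truncated residual is below [c / 2] on [K]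
   and equals [c] at [alpha]. *)
exists alpha, (fun a => 2 / c * truncated_residual c k (toD a) - 1); split => //.
- move=> a.
  apply: (@continuous_comp _ _ _ (truncated_residual c k \o toD)
    (fun t => 2 / c * t - 1)).
    exact: cg.
  apply: cvgB; last exact: cvg_cst.
  by apply: cvgM; [exact: cvg_cst | exact: cvg_id].
- move=> a /Kk /= ak; rewrite subr_le0 mulrAC ler_pdivrMr// mul1r.
  by rewrite -ler_pdivlMl// mulrC ltW.
- have -> : truncated_residual c k (toD alpha) = c.
    by apply: EFin_inj; rewrite truncated_residualE// min_r.
  by rewrite divfK ?gt_eqF//; lra.
Qed.

End DiagramFunctionSpaces.

(** * Membership in the diagram spaces, and conclusion *)

Lemma restr_total_finite {X : Type} (S : set X) (m : X -> option nat) :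
  total_finite m -> total_finite (restr S m).
Proof.
move=> [suppfin mfin]; split=> [|x]; rewrite /restr; last by case: asboolP.
by apply: sub_finite_set suppfin => x /=; case: asboolP.
Qed.

Lemma finite_Dbar {R : realType} {X : Type} (d : X -> X -> \bar R) (A : set X)
    p (a : DgmW d A p) : (1 <= p)%E -> total_finite (sval (a : Dgm A)) ->
  (Wp d A p (l_part d A +oo%E (sval (a : Dgm A))) (@zero_dgm X) < +oo)%E ->
  Dbar d A p a.
Proof.
move=> p1 afin lfin; case: p p1 a afin lfin => [r||]// p1 a afin lfin.
  by split => //; exact: restr_total_finite.
by move=> delta _; exact: restr_total_finite.
Qed.

(** All [M] copies are sent to one point of [A] at finite distance from [x]. *)
Lemma Wp_multiple_lty {R : realType} {X : Type} (d : X -> X -> \bar R)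
    (A : set X) p x M : is_ext_metric d -> (1 <= p)%E ->
  (dist_to d A x < +oo)%E ->
  (Wp d A p (multiple x M) (@zero_dgm X) < +oo)%E.
Proof.
move=> dm p1 /ereal_inf_lt[_ [z Az <-]]; have [d0 _ dC _] := dm.
rewrite Wp_sym// dC => zx; apply: (le_lt_trans (Wp_multiple d x M p1 Az)).
have zxE : d z x = (fine (d z x))%:E by rewrite fineK// ge0_fin_numE.
case: p p1 => [r||]// p1; last first.
  by apply: (le_lt_trans _ zx); apply: ge_ereal_sup => _ [->|[i _ <-]].
rewrite /lnorm poweR_lty// zxE poweR_EFin (@esum_cst _ _ M) ?powR_ge0//.
by rewrite ltry.
Qed.

Theorem theorem7p25 (R : realType) (X : Type) (d : X -> X -> \bar R)
  (A : set X) (Y : topologicalType) (p : \bar R) :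
  is_ext_metric d -> dclosed d A -> ~ isolated_pair d A ->
  has_nontrivial_path R Y -> (1 <= p)%E ->
  ~ metrizable R (Cco (set_type (Dfin d A p)) Y) /\
  ~ metrizable R (Cco (set_type (Dbar d A p)) Y).
Proof.
move=> dm Acl Aiso path p1.
(* [x0] serves as a default point for enumerations and as a point at finite distance from [A]. *)
have [x0 [a [_ x0a _]]] := nonisolated_close dm Acl Aiso ltr01.
have restr_zero S : restr S (@zero_dgm X) = @zero_dgm X.
  by apply/funext => x; rewrite /restr if_same.
split; apply: diagram_Cco_not_metrizable => //.
- by move=> b Eb e; exact: Dfin_residual.
- exact: zero_total_finite.
- by move=> *; exact: multiple_total_finite.
- by move=> b Eb e; exact: Dbar_residual.
- apply: finite_Dbar => //; first exact: zero_total_finite.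
  (* Zero copies of [x0] form the zero diagram, so the finiteness for multiples applies. *)
  have zeroE : @zero_dgm X = multiple x0 0.
    by apply/funext => x; rewrite /multiple if_same.
  by rewrite /l_part restr_zero [X in Wp _ _ _ X]zeroE Wp_multiple_lty// x0a ltry.
- move=> x M Ax xfin; apply: finite_Dbar => //; first exact: multiple_total_finite.
  (* [x] lies outside [A] at finite distance, so the restriction keeps every copy. *)
  have -> : l_part d A +oo%E (multiple x M) = multiple x M.
    apply/funext => y; rewrite /l_part /restr /multiple.
    by case: asboolP => //; case: asboolP => // -> [].
  exact: Wp_multiple_lty.
Qed.
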